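(* Let $k\ge2$ be an integer, let $\mathcal{S}=\{\boldsymbol\psi\in[0,1]^k:\sum_{j=1}^k\psi_j=1\}$, and let $\boldsymbol\psi^*\in\mathcal{S}$. Let $Y_1,Y_2,\dots$ be i.i.d. $\mathrm{MultiNom}(\boldsymbol\psi^* )$, so that $\boldsymbol{Y}^{(n)}=(Y_1,\dots,Y_n)$ has law $\mathrm{MultiNom}(\boldsymbol\psi^* )^{\otimes n}$. Consider the Bayesian model in which $Y_1,\dots,Y_n\mid\boldsymbol\psi$ are i.i.d. $\mathrm{MultiNom}(\boldsymbol\psi)$ and $\boldsymbol\psi$ is uniform on $\mathcal{S}$, reparameterized by $\theta_j=\log(\psi_j/\psi_k)$ for $j=1,\dots,k-1$, with normalizing constant $\pi(\boldsymbol{Y}^{(n)})$ and Laplace approximation $\widetilde\pi_{\mathrm{LA}}(\boldsymbol{Y}^{(n)})$ (computed in the $\boldsymbol\theta$ parameterization) as defined in the context. Then, almost surely, there exists $N_0$ such that for all $n>N_0$, $$\left|\frac{\pi(\boldsymbol{Y}^{(n)})}{\widetilde\pi_{\mathrm{LA}}(\boldsymbol{Y}^{(n)})}-1\right|\ge\frac{1}{5n}.$$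
   Context: $\mathrm{MultiNom}(\boldsymbol\psi)$ denotes the single-trial multinomial (categorical) distribution on $k$ categories with probabilities $\psi_1,\dots,\psi_k$. Let $N_j$ be the number of $i\in\{1,\dots,n\}$ for which $Y_i$ is category $j$, so $\sum_{j=1}^kN_j=n$. In the parameterization $\theta_j=\log(\psi_j/\psi_k)$, with $\boldsymbol\theta\in\mathbb{R}^{k-1}$, the likelihood is $$\pi(\boldsymbol{Y}^{(n)}\mid\boldsymbol\theta)=\exp\Big\{\sum_{j=1}^{k-1}N_j\theta_j-n\log\Big(1+\sum_{j=1}^{k-1}e^{\theta_j}\Big)\Big\},$$ and the prior density induced on $\boldsymbol\theta$ by the uniform distribution on $\mathcal{S}$ is $$\pi(\boldsymbol\theta)=\frac{\Gamma(k)\exp\big(\sum_{j=1}^{k-1}\theta_j\big)}{\big(1+\sum_{j=1}^{k-1}e^{\theta_j}\big)^k}.$$ Set $\pi(\boldsymbol\theta,\boldsymbol{Y}^{(n)})=\pi(\boldsymbol{Y}^{(n)}\mid\boldsymbol\theta)\pi(\boldsymbol\theta)$. The normalizing constant is $\pi(\boldsymbol{Y}^{(n)})=\int_{\mathbb{R}^{k-1}}\pi(\boldsymbol\theta,\boldsymbol{Y}^{(n)})\,d\boldsymbol\theta$. Let $\hat{\boldsymbol\theta}_n=\operatorname{argmax}_{\boldsymbol\theta\in\mathbb{R}^{k-1}}\pi(\boldsymbol\theta,\boldsymbol{Y}^{(n)})$ and let $\hat{\boldsymbol H}_n$ be the negative Hessian matrix of $\boldsymbol\theta\mapsto\log\pi(\boldsymbol\theta,\boldsymbol{Y}^{(n)})$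 at $\hat{\boldsymbol\theta}_n$. The Laplace approximation is $\widetilde\pi_{\mathrm{LA}}(\boldsymbol{Y}^{(n)})=(2\pi)^{(k-1)/2}\,|\hat{\boldsymbol H}_n|^{-1/2}\,\pi(\hat{\boldsymbol\theta}_n,\boldsymbol{Y}^{(n)})$, where $|\cdot|$ is the determinant and the $\pi$ in $(2\pi)^{(k-1)/2}$ is the numerical constant. *)

(* Defs.v *)
From HB Require Import structures.
From mathcomp Require Import all_boot all_order all_algebra.
From mathcomp Require Import all_classical all_reals all_analysis.

Set Implicit Arguments.
Unset Strict Implicit.
Unset Printing Implicit Defensive.

Import Order.TTheory GRing.Theory Num.Theory.
Import numFieldNormedType.Exports.

Local Open Scope classical_set_scope.
Local Open Scope ring_scope.

(* The Lebesgue measure on R^n is the iterated product of the one on R,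
   transported along the bijection R * R^m -> R^m.+1; see
   [lebesgue_measure_tuple_box]. *)
Fixpoint lebesgue_measure_tuple (R : realType) (n : nat) :
    set (n.-tuple R) -> \bar R :=
  if n is m.+1 then
    pushforward (lebesgue_measure \x lebesgue_measure_tuple (n := m))%E
      (fun xt : R * m.-tuple R => [tuple of xt.1 :: xt.2])
  else dirac [tuple].
Arguments lebesgue_measure_tuple : clear implicits.

Section lebesgue_measure_tuple_theory.
Variable R : realType.

Let consf m (xt : R * m.-tuple R) : m.+1.-tuple R := [tuple of xt.1 :: xt.2].

Let measurable_consf m : measurable_fun setT (@consf m).
Proof.
by apply: measurable_cons; [exact: measurable_fst|exact: measurable_snd].
Qed.

Let sigma_finite_exists n :
  exists mu : {sigma_finite_measure set (n.-tuple R) -> \bar R},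
    forall A, mu A = lebesgue_measure_tuple R n A.
Proof.
elim: n => [|m [mu muE]]; first by exists (dirac [tuple]).
pose lam : {sigma_finite_measure set (measurableTypeR R) -> \bar R} :=
  lebesgue_measure.
pose prod : {measure set (measurableTypeR R * m.-tuple R)%type -> \bar R} :=
  (lam \x mu)%E.
have prod_sf : sigma_finite setT prod.
  have /sigma_finiteP[F [TF ndF Foo]] := sigma_finiteT lam.
  have /sigma_finiteP[G [TG ndG Goo]] := sigma_finiteT mu.
  exists (fun i => F i `*` G i).
    rewrite -setXTT TF TG predeqE => -[x y]; split.
      move=> [/= [i _ Fix] [j _ Gjy]]; exists (maxn i j) => //; split.
      - by move: x Fix; exact/subsetPset/ndF/leq_maxl.
      - by move: y Gjy; exact/subsetPset/ndG/leq_maxr.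
    by move=> [i _ []/= ? ?]; split; exists i.
  move=> i; have [? ?] := Foo i; have [? ?] := Goo i.
  split; first exact: measurableX.
  by rewrite /prod/= product_measure1E// lte_mul_pinfty// ge0_fin_numE.
pose nu : {measure set (m.+1.-tuple R) -> \bar R} :=
  measure_function_pushforward__canonical__measure_function_Measure
    prod (@measurable_consf m).
have nu_sf : sigma_finite setT nu.
  have [F FT Foo] := prod_sf.
  pose u (t : m.+1.-tuple R) : R * m.-tuple R := (thead t, [tuple of behead t]).
  have uK : cancel (@consf m) u.
    by move=> [x t]; rewrite /u/consf theadE; congr pair; exact: val_inj.
  have mu_ : measurable_fun setT u.
    apply/measurable_fun_pairP; split; first exact: measurable_tnth.
    exact: measurable_behead.
  exists (fun i => u @^-1` F i); first by rewrite -preimage_bigcup -FT.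
  move=> i; have [mFi Fioo] := Foo i; split.
    by rewrite -[X in measurable X]setTI; exact: mu_.
  rewrite /= /nu/pushforward -comp_preimage.
  by rewrite (_ : u \o _ = id)//; apply/funext => x /=; rewrite uK.
pose nuS := HB.pack_for {sigma_finite_measure set (m.+1.-tuple R) -> \bar R}
  (Measure.sort nu) (Measure.class nu)
  (Measure_isSigmaFinite.Build _ _ _ (Measure.sort nu) nu_sf).
exists nuS => A.
rewrite /= /nu/pushforward.
rewrite (_ : (mu : set _ -> \bar R) = lebesgue_measure_tuple R m)//.
exact/funext.
Qed.

Variable n : nat.
Local Notation leb := (lebesgue_measure_tuple R n).

Let leb0 : leb set0 = 0%E.
Proof. by have [mu <-] := sigma_finite_exists n; rewrite measure0. Qed.

Let leb_ge0 A : (0 <= leb A)%E.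
Proof. by have [mu <-] := sigma_finite_exists n; rewrite measure_ge0. Qed.

Let leb_sigma_additive : semi_sigma_additive leb.
Proof.
have [mu muE] := sigma_finite_exists n.
rewrite (_ : leb = mu); last by apply/funext => A; rewrite muE.
exact: measure_semi_sigma_additive.
Qed.

HB.instance Definition _ := isMeasure.Build _ _ _ leb
  leb0 leb_ge0 leb_sigma_additive.

Let leb_sigma_finite : sigma_finite setT leb.
Proof.
have [mu muE] := sigma_finite_exists n.
rewrite (_ : leb = mu); last by apply/funext => A; rewrite muE.
exact: sigma_finiteT.
Qed.

HB.instance Definition _ := Measure_isSigmaFinite.Build _ _ _ leb
  leb_sigma_finite.

End lebesgue_measure_tuple_theory.

Lemma lebesgue_measure_tuple_box (R : realType) (n : nat)
    (B : 'I_n -> set R) : (forall i, measurable (B i)) ->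
  lebesgue_measure_tuple R n [set t | forall i, B i (tnth t i)] =
  (\prod_(i < n) lebesgue_measure (B i))%E.
Proof.
elim: n B => [B _|n ih B mB].
  by rewrite big_ord0 /= diracE mem_set// => -[].
rewrite big_ord_recl /= /pushforward.
rewrite -(ih (fun i => B (lift ord0 i)))//.
have mbox : measurable
    [set t : n.-tuple R | forall i, B (lift ord0 i) (tnth t i)].
  rewrite (_ : [set t | _] = \bigcap_(i in [set: 'I_n])
      ((fun t : n.-tuple R => tnth t i) @^-1` B (lift ord0 i))).
    apply: fin_bigcap_measurable => // i _; rewrite -[X in measurable X]setTI.
    exact: measurable_tnth.
  by apply/seteqP; split=> t /= Bt i; [move=> _|]; exact: Bt.
rewrite -product_measure1E//; last exact: mB.
congr (_ _); apply/seteqP; split=> -[x t] /=.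
  move=> Bxt; split=> [|i]; first exact: (Bxt ord0).
  by have := Bxt (lift ord0 i); rewrite tnthS.
by move=> [Bx Bt] i; have [j ->|->//] := unliftP ord0 i; rewrite tnthS.
Qed.

Definition simplex (R : realType) (k : nat) : set ('I_k -> R) :=
  [set psi | (forall j, 0 <= psi j <= 1) /\ \sum_(j < k) psi j = 1].
Arguments simplex : clear implicits.

Definition mutually_independent (d : measure_display) (T : measurableType d)
    (R : realType) (P : probability T R) (k : nat) (Y : nat -> T -> 'I_k) :=
  forall (s : seq nat) (B : nat -> set 'I_k), uniq s ->
    P (\bigcap_(i in [set` s]) (Y i @^-1` B i)) =
    (\prod_(i <- s) P (Y i @^-1` B i))%E.

Definition iid_categorical (d : measure_display) (T : measurableType d)
    (R : realType) (P : probability T R) (k : nat) (psi : 'I_k -> R)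
    (Y : nat -> T -> 'I_k) :=
  [/\ forall i B, measurable (Y i @^-1` B),
      forall i j, P (Y i @^-1` [set j]) = (psi j)%:E
    & mutually_independent P Y].

(* Euler's Gamma function, for 0 < x *)
Definition Gamma (R : realType) (x : R) : R :=
  \int[lebesgue_measure]_(t in `]0, +oo[) (t `^ (x - 1) * expR (- t)).

Definition hessian (R : realType) (p : nat) (f : 'rV[R]_p -> R)
    (t : 'rV[R]_p) : 'M[R]_p :=
  \matrix_(i, j) 'D_(delta_mx 0 i) ('D_(delta_mx 0 j) f) t.

(* an arbitrary point if [f] has no maximizer *)
Definition argmax (R : realType) (p : nat) (f : 'rV[R]_p -> R) : 'rV[R]_p :=
  get [set t | forall t', f t' <= f t].

(* The categories are the elements of 'I_k, with the last one as the reference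
   category; theta is a vector of dimension k.-1, whose coordinate j
   corresponds to the category [widen_ord (leq_pred k) j]. *)
Section multinomial_model.
Variables (R : realType) (k n : nat) (y : n.-tuple 'I_k).
Implicit Types theta : 'rV[R]_k.-1.

Definition category_count (j : 'I_k) : nat := count_mem j y.

Definition likelihood theta : R :=
  expR (\sum_(j < k.-1)
          (category_count (widen_ord (leq_pred k) j))%:R * theta 0 j
        - n%:R * ln (1 + \sum_(j < k.-1) expR (theta 0 j))).

Definition prior theta : R :=
  Gamma k%:R * expR (\sum_(j < k.-1) theta 0 j)
  / (1 + \sum_(j < k.-1) expR (theta 0 j)) ^+ k.

Definition joint theta : R := likelihood theta * prior theta.

Definition evidence : R :=
  \int[lebesgue_measure_tuple R k.-1]_t joint (\row_j tnth t j).

Definition posterior_mode : 'rV[R]_k.-1 := argmax joint.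

Definition neg_hessian_at_mode : 'M[R]_k.-1 :=
  - hessian (fun theta => ln (joint theta)) posterior_mode.

Definition laplace_approximation : R :=
  (2 * pi) `^ (k.-1%:R / 2) * (\det neg_hessian_at_mode) `^ (- 2^-1)
  * joint posterior_mode.

End multinomial_model.

Arguments prior R k theta : clear implicits.
Arguments evidence R {k n} y.
Arguments posterior_mode R {k n} y.
Arguments neg_hessian_at_mode R {k n} y.
Arguments laplace_approximation R {k n} y.

(* Main.v *)
Require Import Defs.
From HB Require Import structures.
From mathcomp Require Import all_boot all_order all_algebra.
From mathcomp Require Import all_classical all_reals all_analysis.
From mathcomp Require Import measurable_realfun ring lra.

Import Order.TTheory GRing.Theory Num.Theory.
Import numFieldNormedType.Exports.

Local Open Scope classical_set_scope.
Local Open Scope ring_scope.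

Set Implicit Arguments.
Unset Strict Implicit.
Unset Printing Implicit Defensive.

(** Both the evidence and its Laplace approximation have closed forms, and their
ratio is governed by the error terms of Stirling's formula.

Write a_j = N_j + 1 and A = n + k, so that A is the sum of the a_j.  The joint
density is Gamma(k) exp(sum_(j<k) a_j theta_j) / (1 + sum exp theta_j)^A: up to
Gamma(k), a Dirichlet density in log-ratio coordinates.  Hence
- the evidence is Gamma(k) prod_j Gamma(a_j) / Gamma(A)  ([evidenceE]; Tonelli
  and induction on the dimension, [integral_dirichlet_kernel]);
- the mode is the point where softmax(theta)_j = a_j / A  ([posterior_modeE];
  Gibbs' inequality, whose equality case gives uniqueness);
- with p_j = a_j / A, the negative Hessian there is A (diag p - p^T p), whose
  determinant is A^(k-1) prod_(j<=k) p_j  ([det_neg_hessian_at_mode]; matrix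
  determinant lemma).
Let mu be the remainder in Stirling's formula,
  ln Gamma(x) = (x - 1/2) ln x - x + ln (2 pi) / 2 + mu(x).
All powers and exponentials cancel in the quotient, which leaves exactly
  evidence / laplace_approximation = exp (sum_j mu(a_j) - mu(A))
([evidence_laplace_ratio]).

Robbins' bounds 1/(12 x + 1) <= mu(x) <= 1/(12 x) ([robbins_bounds]) and the
inequality between the arithmetic and harmonic means of the 12 a_j + 1 give
  sum_j mu(a_j) - mu(A) >= k^2 / (12 A + k) - 1 / (12 A),
which is about (k^2 - 1) / (12 n) >= 1 / (4 n).  So for every data set with
n > 100 the exponent is at least 1 / (5 n) ([gap_bound]), and exp x - 1 >= x
concludes.  The worst case is k = 2 with balanced counts, where the limit
constant is 1/4; this is what leaves room for the 1/5. *)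

(** * Stirling's formula with Robbins' bounds *)

Section stirling.
Variable R : realType.
Implicit Types (x : R) (m n : nat).

Lemma eq_ler (x y : R) : x = y -> x <= y. Proof. by move->. Qed.

Lemma le_of_derive_le (f g f' g' : R -> R) (a b : R) : a <= b -> f a <= g a ->
  (forall x, a <= x <= b -> is_derive x 1 f (f' x)) ->
  (forall x, a <= x <= b -> is_derive x 1 g (g' x)) ->
  (forall x, a <= x <= b -> f' x <= g' x) -> f b <= g b.
Proof.
move=> ab fga df dg fg.
have dh x : a <= x <= b -> is_derive x 1 (g - f) (g' x - f' x).
  by move=> xab; apply: is_deriveB; [exact: dg|exact: df].
suff : (g - f) a <= (g - f) b.
  by rewrite /= !fctE => ?; lra.
have ab_ x : x \in `]a, b[ -> a <= x <= b.
  by rewrite in_itv/= => /andP[/ltW-> /ltW->].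
apply: (@ger0_derive1_ndecr _ (g - f) a b) => //.
- by move=> x /ab_/dh[].
- by move=> x /ab_ xab; rewrite derive1E; have [_ ->] := dh _ xab; rewrite subr_ge0 fg.
- apply: derivable_within_continuous => x; rewrite in_itv/= => /dh[] //.
Qed.

(** The two truncations of the series of
2 artanh x = ln ((1 + x) / (1 - x)) = 2 (x + x^3/3 + x^5/5 + ...): dropping the
tail, or bounding it by the geometric series x^3/3 (1 + x^2 + ...). *)
Lemma ln_atanh_ge x : 0 <= x < 1 ->
  x *+ 2 + x ^+ 3 * (2 / 3) <= ln (1 + x) - ln (1 - x).
Proof.
move=> /andP[x0 x1].
pose g (y : R) := ln (1 + y) - ln (1 - y).
pose f (y : R) := y *+ 2 + y ^+ 3 * (2 / 3).
apply: (@le_of_derive_le f g (fun y => 2 + 2 * y ^+ 2) (fun y => (1 + y)^-1 + (1 - y)^-1) 0 x) => //.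
- by rewrite /f /g addr0 subr0 subrr mul0rn expr0n/= mul0r addr0.
- move=> y _; rewrite /f.
  apply: is_derive_eq; rewrite /GRing.scale/=.
  by field.
- move=> y /andP[y0 yx]; rewrite /g.
  have ? : is_derive (1 + y) 1 (@ln R) (1 + y)^-1 by apply: is_derive1_ln; lra.
  have ? : is_derive (1 - y) 1 (@ln R) (1 - y)^-1 by apply: is_derive1_ln; lra.
  apply: is_derive_eq; rewrite /GRing.scale/=.
  by field; lra.
- move=> y /andP[y0 yx].
  rewrite -subr_ge0.
  have -> : (1 + y)^-1 + (1 - y)^-1 - (2 + 2 * y ^+ 2) = 2 * y ^+ 4 / ((1 + y) * (1 - y)).
    field; apply/andP; split; apply/eqP; lra.
  apply: divr_ge0; first by rewrite mulr_ge0// exprn_ge0.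
  apply: mulr_ge0; lra.
Qed.

Lemma ln_atanh_le x : 0 <= x < 1 ->
  ln (1 + x) - ln (1 - x) <= x *+ 2 + x ^+ 3 * (2 / 3) / (1 - x ^+ 2).
Proof.
move=> /andP[x0 x1].
pose g (y : R) := ln (1 + y) - ln (1 - y).
pose f (y : R) := y *+ 2 + y ^+ 3 * (2 / 3) / (1 - y ^+ 2).
apply: (@le_of_derive_le g f (fun y => (1 + y)^-1 + (1 - y)^-1)
  (fun y => 2 + 2 / 3 * (y ^+ 2 * 3 * (1 - y ^+ 2) + y ^+ 4 *+ 2) / (1 - y ^+ 2) ^+ 2) 0 x) => //.
- by rewrite /f /g addr0 subr0 subrr mul0rn expr0n/= !mul0r addr0.
- move=> y /andP[y0 yx]; rewrite /g.
  have ? : is_derive (1 + y) 1 (@ln R) (1 + y)^-1 by apply: is_derive1_ln; lra.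
  have ? : is_derive (1 - y) 1 (@ln R) (1 - y)^-1 by apply: is_derive1_ln; lra.
  apply: is_derive_eq; rewrite /GRing.scale/=.
  by field; lra.
- move=> y /andP[y0 yx]; rewrite /f.
  have y2 : 1 - y ^+ 2 != 0 by apply/eqP; nra.
  apply: is_derive_eq; rewrite /GRing.scale/=.
  by field.
- move=> y /andP[y0 yx].
  rewrite -subr_ge0.
  have -> : 2 + 2 / 3 * (y ^+ 2 * 3 * (1 - y ^+ 2) + y ^+ 4 *+ 2) / (1 - y ^+ 2) ^+ 2
    - ((1 + y)^-1 + (1 - y)^-1) = 4 / 3 * y ^+ 4 / ((1 + y) * (1 - y)) ^+ 2.
    have y2 : 1 - y ^+ 2 != 0 by apply/eqP; nra.
    by field; repeat (apply/andP; split); rewrite ?y2//; lra.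
  apply: divr_ge0; last by rewrite sqr_ge0.
  rewrite mulr_ge0 ?exprn_ge0//; lra.
Qed.

Definition log_stirling_error n : R :=
  ln n`!%:R - (n%:R + 2^-1) * ln n%:R + n%:R.

Local Notation e := log_stirling_error.

(** With x = 1 / (2n + 1) one has (1 + x) / (1 - x) = (n + 1) / n, so the decrement
is artanh x / x - 1 and the truncated series apply. *)
Lemma log_stirling_error_step n : (0 < n)%N ->
  let x : R := (n.*2.+1)%:R^-1 in
  e n - e n.+1 = (x *+ 2)^-1 * (ln (1 + x) - ln (1 - x)) - 1.
Proof.
move=> n0 x.
have n0' : 0 < n%:R :> R by rewrite ltr0n.
have n2 : (n.*2.+1)%:R = n%:R * 2 + 1 :> R by rewrite -natr1 -muln2 natrM.
have -> : 1 + x = 2 * n.+1%:R * x.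
  by rewrite /x n2 -natr1; field; lra.
have -> : 1 - x = 2 * n%:R * x.
  by rewrite /x n2; field; lra.
have x0 : 0 < x by rewrite invr_gt0 ltr0n.
rewrite !lnM ?posrE ?mulr_gt0 ?ltr0n//.
rewrite /log_stirling_error factS natrM lnM ?posrE ?ltr0n ?fact_gt0//.
have -> : (x *+ 2)^-1 = n%:R + 2^-1.
  by rewrite /x n2; field; lra.
by rewrite -natr1; field.
Qed.

Lemma log_stirling_error_step_ge n : (0 < n)%N ->
  (12 * n%:R + 1)^-1 - (12 * n.+1%:R + 1)^-1 <= e n - e n.+1.
Proof.
move=> n0; rewrite log_stirling_error_step//=.
set x : R := (n.*2.+1)%:R^-1.
have n0' : 1 <= n%:R :> R by rewrite ler1n.
have xE : x = (n%:R * 2 + 1)^-1 by rewrite /x -natr1 -muln2 natrM.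
have x0 : 0 < x by rewrite xE invr_gt0; lra.
have x1 : x < 1 by rewrite xE invf_lt1; lra.
have h := @ln_atanh_ge x (introT andP (conj (ltW x0) x1)).
apply: (@le_trans _ _ (x ^+ 2 / 3)); last first.
  rewrite lerBrDl [leRHS]mulrC ler_pdivlMr ?mulrn_wgt0//.
  by apply: le_trans h; apply: eq_ler; field.
rewrite -[n.+1%:R]natr1 xE -subr_ge0.
have -> : (n%:R * 2 + 1)^-1 ^+ 2 / 3 - ((12 * n%:R + 1)^-1 - (12 * (n%:R + 1) + 1)^-1) =
  (24 * n%:R - 23) / (3 * (n%:R * 2 + 1) ^+ 2 * (12 * n%:R + 1) * (12 * (n%:R + 1) + 1)) :> R.
  by field; lra.
apply: divr_ge0; first lra.
by rewrite !mulr_ge0 ?sqr_ge0//; lra.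
Qed.

Lemma log_stirling_error_step_le n : (0 < n)%N ->
  e n - e n.+1 <= (12 * n%:R)^-1 - (12 * n.+1%:R)^-1.
Proof.
move=> n0; rewrite log_stirling_error_step//=.
set x : R := (n.*2.+1)%:R^-1.
have n0' : 1 <= n%:R :> R by rewrite ler1n.
have xE : x = (n%:R * 2 + 1)^-1 by rewrite /x -natr1 -muln2 natrM.
have x0 : 0 < x by rewrite xE invr_gt0; lra.
have x1 : x < 1 by rewrite xE invf_lt1; lra.
have h := @ln_atanh_le x (introT andP (conj (ltW x0) x1)).
rewrite lerBlDl [leLHS]mulrC ler_pdivrMr ?mulrn_wgt0//.
apply: (le_trans h); apply: eq_ler; rewrite -[n.+1%:R]natr1 xE.
by field; repeat (apply/andP; split); try lra; apply/eqP; nra.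
Qed.

(** A primitive of [sin ^+ n] given by the reduction formula, so that the Wallis
integrals below are differences of values and no integration is needed. *)
Fixpoint sin_pow_primitive n : R -> R :=
  if n isn't m.+1 then fun x => x else
  if m isn't p.+1 then fun x => - cos x else
  fun x => (m%:R * sin_pow_primitive p x - sin x ^+ m * cos x) / m.+1%:R.

Lemma sin_pow_primitiveSS p x : sin_pow_primitive p.+2 x =
  (p.+1%:R * sin_pow_primitive p x - sin x ^+ p.+1 * cos x) / p.+2%:R.
Proof. by []. Qed.

Lemma is_derive_sin_pow_primitive n x :
  is_derive x 1 (sin_pow_primitive n) (sin x ^+ n).
Proof.
elim/ltn_ind: n => -[_|[_|n ih]].
- exact: is_derive_id.
- rewrite (_ : sin_pow_primitive 1 = - cos)//.
  by apply: is_derive_eq; rewrite opprK expr1.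
- rewrite (_ : sin_pow_primitive n.+2 =
    n.+2%:R^-1 *: (n.+1%:R *: sin_pow_primitive n - sin ^+ n.+1 * cos)); last first.
    by apply/funext => y; rewrite sin_pow_primitiveSS [LHS]mulrC !fctE.
  have ? := ih n (leqnSn _).
  apply: is_derive_eq; rewrite /GRing.scale/= !fctE.
  have c2 : cos x * cos x = 1 - sin x ^+ 2 by rewrite -expr2 cos2sin2.
  have n2 : n.+2%:R != 0 :> R by rewrite pnatr_eq0.
  apply: (mulfI n2); rewrite mulVKf//.
  rewrite [cos x * _]mulrCA c2 !exprS -[n.+2%:R]natr1 -[n.+1%:R]natr1; ring.
Qed.

(** The integral of [sin ^+ n] over [[0, pi/2]]. *)
Definition wallis n := sin_pow_primitive n (pi / 2) - sin_pow_primitive n 0.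

Lemma wallis0 : wallis 0 = pi / 2. Proof. by rewrite /wallis/= subr0. Qed.

Lemma wallis1 : wallis 1 = 1.
Proof. by rewrite /wallis/= cos_pihalf cos0 opprK oppr0 add0r. Qed.

Lemma wallisSS n : wallis n.+2 = n.+1%:R / n.+2%:R * wallis n.
Proof.
rewrite /wallis !sin_pow_primitiveSS cos_pihalf sin0 expr0n/= mulr0 mul0r !subr0.
by rewrite -mulrBl -mulrBr mulrAC.
Qed.

Lemma wallis_gt0 n : 0 < wallis n.
Proof.
elim/ltn_ind: n => -[_|[_|n ih]].
- by rewrite wallis0 divr_gt0// pi_gt0.
- by rewrite wallis1.
- by rewrite wallisSS mulr_gt0// ?divr_gt0// ih.
Qed.

Lemma wallis_nonincreasing n : wallis n.+1 <= wallis n.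
Proof.
pose c k x := sin_pow_primitive k x - sin_pow_primitive k 0.
have dc k x : is_derive x 1 (c k) (sin x ^+ k).
  rewrite /c; have ? := is_derive_sin_pow_primitive k x.
  by apply: is_derive_eq; rewrite subr0.
apply: (@le_of_derive_le (c n.+1) (c n) (fun x => sin x ^+ n.+1) (fun x => sin x ^+ n) 0 (pi / 2)).
- by rewrite divr_ge0// pi_ge0.
- by rewrite /c !subrr.
- move=> x /andP[x0 x1]; rewrite exprSr ler_piMr ?sin_le1//.
  have p0 := pi_gt0 R.
  by rewrite exprn_ge0// sin_ge0_pi// x0/=; lra.
Qed.

(** Consecutive terms have a known product and [wallis] is nonincreasing, so each
[wallis n ^+ 2], n > 0, lies between the products at n - 1 and n, which is Wallis'
formula. *)
Lemma wallis_prod n : n.+1%:R * (wallis n * wallis n.+1) = pi / 2.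
Proof.
elim: n => [|n ih]; first by rewrite wallis0 wallis1 mulr1 mul1r.
have aux (a b w c : R) : c != 0 -> c * (b * (a / c * w)) = a * (w * b).
  by move=> c0; field.
by rewrite wallisSS aux ?pnatr_eq0.
Qed.

Lemma wallis_even m :
  wallis m.*2 = pi / 2 * (m.*2`!%:R / (4 ^+ m * m`!%:R ^+ 2)).
Proof.
elim: m => [|m ih].
  by rewrite wallis0 double0 fact0 expr0 expr1n mulr1 divr1 mulr1.
rewrite doubleS wallisSS ih !factS !natrM [4 ^+ m.+1]exprS.
have m0 : m`!%:R != 0 :> R by rewrite pnatr_eq0 -lt0n fact_gt0.
have m1 : m.+1%:R != 0 :> R by rewrite pnatr_eq0.
have -> : m.*2.+2%:R = 2 * m.+1%:R :> R by rewrite -doubleS -muln2 natrM mulrC.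
have m4 : 4 ^+ m != 0 :> R by rewrite expf_neq0// pnatr_eq0.
by move: m0 m1 m4; move: (m`!%:R) (m.+1%:R) (4 ^+ m) => a b c *; field; do ?[apply/andP; split].
Qed.

Definition central_ratio m : R := m.*2`!%:R / (4 ^+ m * m`!%:R ^+ 2).

Lemma central_ratio_gt0 m : 0 < central_ratio m.
Proof. by rewrite divr_gt0 ?mulr_gt0 ?exprn_gt0 ?ltr0n ?fact_gt0. Qed.

Lemma central_ratio_sqr_le m : (0 < m)%N -> central_ratio m ^+ 2 <= (pi * m%:R)^-1.
Proof.
move=> m0; have p0 := pi_gt0 R; have m0' : 0 < m%:R :> R by rewrite ltr0n.
have w2 : wallis m.*2 = pi / 2 * central_ratio m by rewrite wallis_even.
have h := wallis_prod m.*2.-1.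
rewrite prednK ?double_gt0// in h.
have h1 := wallis_nonincreasing m.*2.-1.
rewrite prednK ?double_gt0// in h1.
have w0 := wallis_gt0 m.*2.
have := ler_wpM2r (ltW w0) h1.
have -> : wallis m.*2.-1 * wallis m.*2 = pi / 2 / m.*2%:R.
  by rewrite -h [RHS]mulrC mulKf// pnatr_eq0 double_eq0 -lt0n.
rewrite w2 -muln2 natrM => h2.
rewrite -(@ler_pM2l _ ((pi / 2) ^+ 2)) ?exprn_gt0 ?divr_gt0//.
apply: (le_trans _ (le_trans h2 _)); apply: eq_ler; first ring.
by field; lra.
Qed.

Lemma central_ratio_sqr_ge m : (pi * (m%:R + 2^-1))^-1 <= central_ratio m ^+ 2.
Proof.
have p0 := pi_gt0 R; have m0' : 0 <= m%:R :> R by rewrite ler0n.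
have w2 : wallis m.*2 = pi / 2 * central_ratio m by rewrite wallis_even.
have h := wallis_prod m.*2.
have h1 := wallis_nonincreasing m.*2.
have w0 := wallis_gt0 m.*2.
have := ler_wpM2l (ltW w0) h1.
have -> : wallis m.*2 * wallis m.*2.+1 = pi / 2 / m.*2.+1%:R.
  by rewrite -h [RHS]mulrC mulKf// pnatr_eq0.
rewrite w2 -[m.*2.+1%:R]natr1 -muln2 natrM => h2.
rewrite -(@ler_pM2l _ ((pi / 2) ^+ 2)) ?exprn_gt0 ?divr_gt0//.
apply: (le_trans _ (le_trans h2 _)); apply: eq_ler; last ring.
by field; lra.
Qed.

Local Notation C := (ln (2 * pi) / 2 : R).

(** In [2 e m - e (2m)] all terms but the central binomial coefficient cancel, so
this combination, which tends to the same limit as [e], is known from Wallis. *)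
Lemma log_stirling_error_double m : (0 < m)%N ->
  (e m *+ 2 - e m.*2) *+ 2 = ln 2 - ln m%:R - ln (central_ratio m ^+ 2).
Proof.
move=> m0.
rewrite lnXn ?central_ratio_gt0// /central_ratio.
rewrite ln_div ?posrE ?mulr_gt0 ?exprn_gt0 ?ltr0n ?fact_gt0//.
rewrite lnM ?posrE ?exprn_gt0 ?ltr0n ?fact_gt0//.
rewrite !lnXn ?ltr0n ?fact_gt0//.
have -> : ln 4 = ln 2 *+ 2 :> R by rewrite -lnXn// -natrX.
rewrite /log_stirling_error -muln2 natrM lnM ?posrE ?ltr0n//.
rewrite -[_ *+ m]mulr_natl; by field.
Qed.

Lemma log_stirling_error_double_bounds m : (0 < m)%N ->
  C <= e m *+ 2 - e m.*2 <= C + (4 * m%:R)^-1.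
Proof.
move=> m0; have h := log_stirling_error_double m0.
have p0 := pi_gt0 R; have m0' : 0 < m%:R :> R by rewrite ltr0n.
have b0 := central_ratio_gt0 m.
have u := central_ratio_sqr_le m0.
have l := central_ratio_sqr_ge m.
have m1 : 0 < m%:R + 2^-1 :> R by lra.
rewrite -ler_ln ?posrE ?exprn_gt0 ?invr_gt0 ?mulr_gt0// in u.
rewrite -ler_ln ?posrE ?exprn_gt0 ?invr_gt0 ?mulr_gt0// in l.
rewrite lnV ?posrE ?mulr_gt0// lnM ?posrE// in u.
rewrite lnV ?posrE ?mulr_gt0// lnM ?posrE// in l.
have CE : C *+ 2 = ln 2 + ln pi by rewrite lnM ?posrE//; field.
have lm : ln (m%:R + 2^-1) <= ln m%:R + (2 * m%:R)^-1 :> R.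
  have -> : m%:R + 2^-1 = m%:R * (1 + (2 * m%:R)^-1) :> R by field; lra.
  have ? : 0 < (2 * m%:R)^-1 :> R by rewrite invr_gt0 mulr_gt0.
  have ? : 0 < 1 + (2 * m%:R)^-1 :> R by lra.
  rewrite lnM ?posrE//.
  by rewrite lerD2l le_ln1Dx//; lra.
have i2 : (2 * m%:R)^-1 = (4 * m%:R)^-1 *+ 2 :> R by field; lra.
by apply/andP; split; lra.
Qed.

Definition stirling_remainder n : R := log_stirling_error n - C.

(** By the bounds on the decrements of [e], the sequence e n - 1/(12n) is
nondecreasing and e n - 1/(12n+1) is nonincreasing, so both bound their common
limit L.  Then 2 e m - e (2m) is within O(1/m) of L, and also of C by Wallis;
hence L = C. *)
Lemma robbins_bounds n : (0 < n)%N ->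
  (12 * n%:R + 1)^-1 <= stirling_remainder n <= (12 * n%:R)^-1.
Proof.
pose u k := e k.+1 - (12 * k.+1%:R)^-1.
pose v k := e k.+1 - (12 * k.+1%:R + 1)^-1.
have aux (a b c d : R) : a - b <= c - d -> a - c <= b - d by move=> ?; lra.
have aux' (a b c d : R) : c - d <= a - b -> b - d <= a - c by move=> ?; lra.
have ndu : nondecreasing_seq u.
  apply/nondecreasing_seqP => k; rewrite /u.
  have := log_stirling_error_step_le (ltn0Sn k); exact: aux.
have niv : nonincreasing_seq v.
  apply/nonincreasing_seqP => k; rewrite /v.
  have := log_stirling_error_step_ge (ltn0Sn k); exact: aux'.
have uv k : u k <= v k.
  rewrite /u /v lerB// lef_pV2 ?posrE ?mulr_gt0 ?addr_gt0 ?mulr_gt0 ?ltr0n//.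
  by rewrite lerDl.
have cu : cvgn u.
  apply: nondecreasing_is_cvgn => //; exists (v 0%N) => _ [k _ <-].
  by rewrite (le_trans (uv k))// niv.
have cv : cvgn v.
  apply: nonincreasing_is_cvgn => //; exists (u 0%N) => _ [k _ <-].
  by rewrite (le_trans _ (uv k))// ndu.
pose L := limn u.
have uL k : u k <= L by exact: nondecreasing_cvgn_le.
have Lv k : L <= v k.
  apply: limr_le => //; near=> j.
  have kj : (k <= j)%N by near: j; exact: nbhs_infty_ge.
  by rewrite (le_trans (uv j))// niv.
have eL m : (0 < m)%N -> L + (12 * m%:R + 1)^-1 <= e m <= L + (12 * m%:R)^-1.
  case: m => // m _; apply/andP; split.
    by rewrite -lerBrDr; exact: Lv.
  by rewrite -lerBlDr; exact: uL.
rewrite /stirling_remainder; suff -> : C = L.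
  by move=> /eL; rewrite lerBrDl lerBlDl.
have close m : (0 < m)%N -> `|C - L| <= m%:R^-1.
  move=> m0; have m0' : 0 < m%:R :> R by rewrite ltr0n.
  have /andP[c1 c2] := log_stirling_error_double_bounds m0.
  have /andP[e1 e2] := eL m m0.
  have mm : (0 < m.*2)%N by rewrite double_gt0.
  have /andP[e3 e4] := eL _ mm.
  have i0 : 0 < m%:R^-1 :> R by rewrite invr_gt0.
  rewrite -muln2 natrM in e3 e4 *.
  (* all quantities in terms of 1/m, for linear arithmetic *)
  have j1 : (12 * (m%:R * 2))^-1 = m%:R^-1 / 24 :> R by field; lra.
  have j2 : (12 * m%:R)^-1 = m%:R^-1 / 12 :> R by field; lra.
  have j3 : (4 * m%:R)^-1 = m%:R^-1 / 4 :> R by field; lra.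
  have j4 : 0 < (12 * (m%:R * 2) + 1)^-1 :> R by rewrite invr_gt0; lra.
  have j5 : 0 < (12 * m%:R + 1)^-1 :> R by rewrite invr_gt0; lra.
  rewrite j1 j2 j3 -muln2 in e1 e2 e3 e4 c1 c2 *.
  rewrite ler_norml; apply/andP; split; lra.
apply/eqP; rewrite -subr_eq0 -normr_le0; apply/ler_addgt0Pr => eps eps0.
rewrite add0r; have [m m0 meps] : exists2 m, (0 < m)%N & m%:R^-1 <= eps.
  exists (Num.truncn eps^-1).+1 => //.
  by rewrite invf_ple ?posrE ?ltr0n// ltW// truncnS_gt.
exact: le_trans (close m m0) meps.
Unshelve. all: by end_near. Qed.

End stirling.

(** * The Dirichlet integral in log-ratio coordinates *)

Lemma cvg_expn {R : realType} {T : Type} (F : set_system T) {FF : Filter F}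
    (f : T -> R) (l : R) n :
  f x @[x --> F] --> l -> f x ^+ n @[x --> F] --> l ^+ n.
Proof.
move=> fl; elim: n => [|n ih]; first exact: cvg_cst.
under eq_fun do rewrite exprS.
by rewrite exprS; exact: cvgM.
Qed.

Section logistic_integral.
Context {R : realType}.
Local Notation mu := (@lebesgue_measure R).

(** The second fundamental theorem of calculus on the whole line, by cutting at 0
and reflecting the negative half-line. *)
Lemma ge0_continuous_FTC2T (f F : R -> R) (l m : R) :
  (forall x, 0 <= f x) -> continuous f ->
  (forall x : R, is_derive x 1 F (f x)) ->
  F x @[x --> -oo] --> l -> F x @[x --> +oo] --> m ->
  (\int[mu]_x (f x)%:E = (m - l)%:E)%E.
Proof.
move=> f0 cf dF Fl Fm.
have mf : measurable_fun [set: R] f by exact: continuous_measurable_fun.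
have cF : continuous F.
  move=> x; apply: differentiable_continuous; apply/derivable1_diffP; exact: ex_derive.
rewrite -(setUv [set x : R | 0 <= x]) -set_itvcy ge0_integral_setU//= ; last 4 first.
  exact: measurableC.
  by apply/measurable_EFinP; rewrite setUv.
  by move=> x _; rewrite lee_fin.
  exact/disj_setPCl.
rewrite (@ge0_continuous_FTC2y _ f F 0 m)//; last 3 first.
- exact: continuous_subspaceT.
- exact/cvg_at_right_filter/cF.
- by move=> x _; rewrite derive1E; have [_ ->] := dF x.
rewrite setCitvr integral_itv_bndo_bndc; last exact/measurable_EFinP/measurable_funTS.
have -> : (\int[mu]_(x in `]-oo, 0%R]) (f x)%:E =
    \int[mu]_(x in `[0%R, +oo[) ((f \o -%R) x)%:E)%E.
  rewrite -[in LHS]oppr0 ge0_integration_by_substitutionNy//.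
  exact: continuous_subspaceT.
rewrite (@ge0_continuous_FTC2y _ (f \o -%R) (fun x => - F (- x)) 0 (- l))//; last 5 first.
- by move=> x _ /=.
- apply: continuous_subspaceT => x; apply: continuous_comp; last exact: cf.
  exact: opp_continuous.
- by apply: cvgN; exact/(cvgNy_compNP F).
- apply: cvgN; apply/cvg_at_right_filter.
  by apply: continuous_comp; [exact: opp_continuous|exact: cF].
- move=> x _; rewrite derive1E; have ? := dF (- x).
  by apply: derive_val; apply: is_derive_eq; rewrite /GRing.scale/= mulrN1 opprK.
by rewrite oppr0 -!EFinB -EFinD; congr EFin; ring.
Qed.

(** In the variable x, u = e^x / (s + e^x) and v = 1 / (s + e^x) satisfy
u' = s u v, v' = - u v and u + s v = 1, so (u^i v^b)' is the combination
i u^i v^b - (i + b) u^(i+1) v^b of integrands.  Reading this as a reduction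
formula in i yields primitives of all u^(a+1) v^(b+1) and hence Beta integrals. *)
Variable s : R.
Hypothesis s0 : 0 < s.

Let u (x : R) : R := expR x / (s + expR x).
Let v (x : R) : R := (s + expR x)^-1.

Let se_gt0 x : 0 < s + expR x. Proof. by rewrite addr_gt0// expR_gt0. Qed.

Let dv (x : R) : is_derive x 1 v (- (u x * v x)).
Proof.
have se := lt0r_neq0 (se_gt0 x).
rewrite /v; apply: is_derive_eq; rewrite /GRing.scale/= /u /v.
by field.
Qed.

Let du (x : R) : is_derive x 1 u (s * u x * v x).
Proof.
have ? := dv x; have se := lt0r_neq0 (se_gt0 x).
suff: is_derive x 1 (expR * v) (s * u x * v x) by [].
apply: is_derive_eq; rewrite /GRing.scale/= /u /v.
by field.
Qed.

Let uv1 x : u x + s * v x = 1.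
Proof.
have se := lt0r_neq0 (se_gt0 x).
by rewrite /u /v; field.
Qed.

Let cvg_expRNy : @expR R x @[x --> -oo] --> (0 : R).
Proof. by apply/cvgNy_compNP; exact: cvgr_expR. Qed.

Let cvg_vNy : v x @[x --> -oo] --> s^-1.
Proof.
apply: cvgV; first by rewrite gt_eqF.
rewrite -[X in _ --> X]addr0; apply: cvgD => //; exact: cvg_cst.
Qed.

Let cvg_uNy : u x @[x --> -oo] --> (0 : R).
Proof. by rewrite -(mul0r s^-1); apply: cvgM. Qed.

Let cvg_uy : u x @[x --> +oo] --> (1 : R).
Proof.
have -> : u = (fun x => (1 + s * expR (- x))^-1).
  apply/funext => x; have e0 := expR_gt0 x; have ? := se_gt0 x.
  by rewrite /u expRN; field; repeat (apply/andP; split); apply: lt0r_neq0; lra.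
rewrite -[X in _ --> X]invr1; apply: cvgV => //.
rewrite -[X in _ --> X]addr0; apply: cvgD; first exact: cvg_cst.
rewrite -[X in _ --> X](mulr0 s); apply: cvgMr; exact: cvgr_expR.
Qed.

Let cvg_vy : v x @[x --> +oo] --> (0 : R).
Proof.
have -> : v = (fun x => (1 - u x) / s).
  by apply/funext => x; rewrite -(uv1 x); field; rewrite gt_eqF.
rewrite -(mul0r s^-1) -[X in X / _](subrr 1); apply: cvgM; last exact: cvg_cst.
by apply: cvgB => //; exact: cvg_cst.
Qed.

Let logistic_kernel_primitive a b : exists K l m,
  [/\ forall x : R, is_derive x 1 K (u x ^+ a.+1 * v x ^+ b.+1),
      K x @[x --> -oo] --> l, K x @[x --> +oo] --> m &
      m - l = (a`! * b`!)%:R / (a + b).+1`!%:R / s ^+ b.+1].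
Proof.
have dk i (x : R) : is_derive x 1 (u ^+ i * v ^+ b.+1)
    (i%:R * (u x ^+ i * v x ^+ b.+1)
     - (i + b).+1%:R * (u x ^+ i.+1 * v x ^+ b.+1)).
  have ? := du x; have ? := dv x.
  apply: is_derive_eq; rewrite /GRing.scale/= !fctE.
  have sv : s * v x = 1 - u x by rewrite -(uv1 x) addrC addKr.
  case: i => [|i].
    rewrite /= !exprS; ring.
  have -> : s * u x * v x = u x * (1 - u x) by rewrite -sv; ring.
  have -> : (i.+1 + b).+1%:R = i.+1%:R + b.+1%:R :> R by rewrite -natrD addnS.
  rewrite /= !exprS; ring.
have nz i : (i + b).+1%:R != 0 :> R by rewrite pnatr_eq0.
have kE i : u ^+ i * v ^+ b.+1 = (fun x => u x ^+ i * v x ^+ b.+1).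
  by apply/funext => x; rewrite !fctE.
have cN i : (u ^+ i * v ^+ b.+1) x @[x --> -oo] --> (0 : R) ^+ i * s^-1 ^+ b.+1.
  by rewrite kE; apply: cvgM; exact: cvg_expn.
have cy i : (u ^+ i * v ^+ b.+1) x @[x --> +oo] --> (1 : R) ^+ i * 0 ^+ b.+1.
  by rewrite kE; apply: cvgM; exact: cvg_expn.
elim: a => [|a [K [l [m [dK Kl Km lm]]]]].
  (* [dk] at i = 0 reads (v^(b+1))' = - (b + 1) u v^(b+1) *)
  pose c : R := - b.+1%:R^-1.
  exists (c *: (u ^+ 0 * v ^+ b.+1)),
    (c * (0 ^+ 0 * s^-1 ^+ b.+1)), (c * (1 ^+ 0 * 0 ^+ b.+1)).
  split.
  - move=> x; have ? := dk 0%N x.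
    apply: is_derive_eq; rewrite /GRing.scale/= add0n mul0r sub0r.
    by rewrite /c mulrNN mulKf// nz.
  - by apply: cvgMr; exact: cN.
  - by apply: cvgMr; exact: cy.
  - rewrite expr0n/= mulr0 mulr0 sub0r expr0 mul1r add0n fact0 mul1n factS natrM exprVn.
    have ? : b`!%:R != 0 :> R by rewrite pnatr_eq0 -lt0n fact_gt0.
    by rewrite /c mulNr opprK invfM [b`!%:R * _]mulrCA divff// mulr1.
(* [dk] at i = a + 1, solved for u^(a+2) v^(b+1) *)
pose c : R := (a.+1 + b).+1%:R.
exists (c^-1 *: (a.+1%:R *: K - u ^+ a.+1 * v ^+ b.+1)),
    (c^-1 * (a.+1%:R * l - 0 ^+ a.+1 * s^-1 ^+ b.+1)),
    (c^-1 * (a.+1%:R * m - 1 ^+ a.+1 * 0 ^+ b.+1)).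
split.
- move=> x; have ? := dk a.+1 x; have ? := dK x.
  apply: is_derive_eq; rewrite /GRing.scale/= opprB addrCA subrr addr0.
  by rewrite mulKf// nz.
- by apply: cvgMr; apply: cvgB; [exact: cvgMr|exact: cN].
- by apply: cvgMr; apply: cvgB; [exact: cvgMr|exact: cy].
- rewrite !expr0n/= mulr0 mul0r !subr0 -!mulrBr lm.
  rewrite !mulrA; congr (_ * _).
  have -> : (a.+1 + b).+1`! = ((a.+1 + b).+1 * (a + b).+1`!)%N by rewrite factS.
  rewrite (factS a) !(natrM _ _ b`!) (natrM _ _ a`!) (natrM _ _ (a + b).+1`!).
  rewrite invfM -/c !mulrA.
  by congr (_ / _); rewrite [RHS]mulrC !mulrA.
Qed.

Lemma integral_logistic_kernel a b :
  (\int[mu]_x (expR (a.+1%:R * x) / (s + expR x) ^+ (a + b).+2)%:E =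
   ((a`! * b`!)%:R / (a + b).+1`!%:R / s ^+ b.+1)%:E)%E.
Proof.
have [K [l [m [dK Kl Km <-]]]] := logistic_kernel_primitive a b.
have fE x : expR (a.+1%:R * x) / (s + expR x) ^+ (a + b).+2 = u x ^+ a.+1 * v x ^+ b.+1.
  rewrite /u /v expr_div_n -expRM_natl mulr_natl -addSn -addnS exprD invfM exprVn mulrA //.
apply: (ge0_continuous_FTC2T _ _ _ Kl Km).
- by move=> x; rewrite divr_ge0 ?expR_ge0 ?exprn_ge0// ltW.
- rewrite (_ : (fun x => _) = (fun x => u x ^+ a.+1 * v x ^+ b.+1)); last exact/funext.
  move=> x; apply: cvgM; apply: cvg_expn; apply: differentiable_continuous;
    apply/derivable1_diffP; exact: ex_derive.
- by move=> x; rewrite fE; exact: dK.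
Qed.

End logistic_integral.

Lemma measurable_fun_posV {R : realType} {d} {T : measurableType d} (g : T -> R) :
  (forall t, 0 < g t) -> measurable_fun setT g ->
  measurable_fun setT (fun t => (g t)^-1).
Proof.
move=> g0 mg; rewrite (_ : (fun t => _) = (fun t => expR (- ln (g t)))).
  apply: measurableT_comp; first exact: measurable_expR.
  apply: measurable_funN; apply: measurableT_comp => //; exact: measurable_ln.
by apply/funext => t; rewrite expRN lnK// posrE.
Qed.

Section dirichlet_integral.
Context {R : realType}.
Local Notation mu := (@lebesgue_measure R).
Local Notation lebT := (@lebesgue_measure_tuple R).

Lemma ge0_integral_tupleS m (f : m.+1.-tuple R -> \bar R) :
  measurable_fun setT f -> (forall t, (0 <= f t)%E) ->
  (\int[lebT m.+1]_t f t = \int[mu]_x \int[lebT m]_t f [tuple of x :: t])%E.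
Proof.
move=> mf f0.
pose consf (xt : R * m.-tuple R) : m.+1.-tuple R := [tuple of xt.1 :: xt.2].
have mc : measurable_fun setT consf.
  by apply: measurable_cons; [exact: measurable_fst|exact: measurable_snd].
pose prod : {measure set (measurableTypeR R * m.-tuple R)%type -> \bar R} :=
  (mu \x lebT m)%E.
transitivity (\int[pushforward prod consf]_t f t)%E.
  by apply: eq_measure_integral.
rewrite ge0_integral_pushforward//= ?preimage_setT.
rewrite /prod fubini_tonelli1//.
exact: measurableT_comp.
Qed.

(** The unnormalized Dirichlet density with parameters [a i + 1], [b + 1] in
log-ratio coordinates.  The offset [s], equal to 1 in the model, is what makes the
family stable under integrating out all but one coordinate x: it becomes
[s + expR x]. *)
Definition dirichlet_kernel m (a : 'I_m -> nat) b (s : R) (t : m.-tuple R) : R :=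
  expR (\sum_i (a i).+1%:R * tnth t i) /
  (s + \sum_i expR (tnth t i)) ^+ (\sum_i (a i).+1 + b.+1).

Lemma dirichlet_kernel_ge0 m (a : 'I_m -> nat) b s (t : m.-tuple R) : 0 < s ->
  0 <= dirichlet_kernel a b s t.
Proof.
move=> s0; rewrite divr_ge0 ?expR_ge0// exprn_ge0// addr_ge0 ?(ltW s0)//.
by apply: sumr_ge0 => i _; exact: expR_ge0.
Qed.

Lemma measurable_dirichlet_kernel m (a : 'I_m -> nat) b s : 0 < s ->
  measurable_fun setT (@dirichlet_kernel m a b s).
Proof.
move=> s0; apply: measurable_funM.
  apply: measurableT_comp; first exact: measurable_expR.
  apply: measurable_sum => i; apply: measurable_funM; first exact: measurable_cst.
  exact: measurable_tnth.
apply: measurable_fun_posV => [t|].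
  rewrite exprn_gt0// ltr_wpDr//; apply: sumr_ge0 => i _; exact: expR_ge0.
apply: measurable_funX; apply: measurable_funD; first exact: measurable_cst.
apply: measurable_sum => i; apply: measurableT_comp; first exact: measurable_expR.
exact: measurable_tnth.
Qed.

(** Integrate the last coordinates first: by induction they contribute a power of
s + e^x, which merges with the factor of the first coordinate x into a one-dimensional
Beta integral. *)
Lemma integral_dirichlet_kernel m (a : 'I_m -> nat) b (s : R) : 0 < s ->
  (\int[lebT m]_t (dirichlet_kernel a b s t)%:E =
  (((\prod_i (a i)`!) * b`!)%:R / (\sum_i (a i).+1 + b)`!%:R / s ^+ b.+1)%:E)%E.
Proof.
elim: m a b s => [|m ih] a b s s0.
  transitivity (\int[dirac ([tuple] : 0.-tuple R)]_t (dirichlet_kernel a b s t)%:E)%E.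
    exact: eq_measure_integral.
  rewrite integral_dirac//; last by apply/measurable_EFinP; exact: measurable_dirichlet_kernel.
  rewrite diracT mul1e /dirichlet_kernel !big_ord0 expR0 addr0 !add0n.
  by rewrite mul1n divff ?pnatr_eq0 -?lt0n ?fact_gt0.
rewrite ge0_integral_tupleS; last 2 first.
- by apply/measurable_EFinP; exact: measurable_dirichlet_kernel.
- by move=> t; rewrite lee_fin dirichlet_kernel_ge0.
pose a0 := a ord0; pose a' i := a (lift ord0 i).
have step x (t : m.-tuple R) : dirichlet_kernel a b s [tuple of x :: t] =
    expR (a0.+1%:R * x) * dirichlet_kernel a' (a0 + b).+1 (s + expR x) t.
  rewrite /dirichlet_kernel !big_ord_recl/=.
  under eq_bigr do rewrite tnthS.
  under [X in (s + (_ + X))]eq_bigr do rewrite tnthS.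
  rewrite tnth0 expRD -mulrA addrA; congr (_ * (_ / _ ^+ _)).
  by rewrite -/a0 !addnS !addSn addnCA addnA.
pose C : R := ((\prod_i (a' i)`!) * (a0 + b).+1`!)%:R / (\sum_i (a' i).+1 + (a0 + b).+1)`!%:R.
have C0 : 0 <= C by rewrite divr_ge0.
transitivity (\int[mu]_x (C%:E * (expR (a0.+1%:R * x) / (s + expR x) ^+ (a0 + b).+2)%:E))%E.
  apply: eq_integral => x _.
  have sx : 0 < s + expR x by rewrite addr_gt0// expR_gt0.
  under eq_integral do rewrite step EFinM.
  rewrite ge0_integralZl//; last 2 first.
  - by apply/measurable_EFinP; exact: measurable_dirichlet_kernel.
  - by move=> t _; rewrite lee_fin dirichlet_kernel_ge0.
  by rewrite ih// -!EFinM -/C mulrCA mulrA.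
rewrite ge0_integralZl//; last 2 first.
- apply/measurable_EFinP; apply: measurable_funM.
    apply: measurableT_comp; first exact: measurable_expR.
    by apply: measurable_funM => //; exact: measurable_cst.
  apply: measurable_fun_posV => [x|].
    by rewrite exprn_gt0// addr_gt0// expR_gt0.
  apply: measurable_funX; apply: measurable_funD; first exact: measurable_cst.
  exact: measurable_expR.
- by move=> x _; rewrite lee_fin divr_ge0 ?expR_ge0// exprn_ge0// addr_ge0 ?expR_ge0// ltW.
rewrite integral_logistic_kernel// -EFinM /C; congr EFin.
rewrite !big_ord_recl/= -/a0 mulrA; congr (_ / _).
have nz k : k`!%:R != 0 :> R by rewrite pnatr_eq0 -lt0n fact_gt0.
have -> : (\sum_i (a' i).+1 + (a0 + b).+1 = a0.+1 + \sum_(i < m) (a (lift ord0 i)).+1 + b)%N.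
  by rewrite /a' addnS !addSn addnCA addnA.
set N := (a0.+1 + _ + b)%N.
move: (nz (a0 + b).+1) (nz N); move: ((a0 + b).+1`!) (N`!) => F G F0 G0.
by rewrite /a' !natrM; field; rewrite F0 G0.
Qed.
End dirichlet_integral.

(** * The evidence *)

Section Gamma.
Context {R : realType}.
Local Notation mu := (@lebesgue_measure R).

Lemma cvg_expn_expRN n : x ^+ n * expR (- x) @[x --> +oo] --> (0 : R).
Proof.
apply: (@squeeze_cvgr _ _ _ _ (cst 0) (fun x => n.+1`!%:R * x^-1)).
- near=> x.
  have x0 : 0 < x by near: x; exact: nbhs_pinfty_gt.
  rewrite /= mulr_ge0 ?expR_ge0 ?exprn_ge0 ?(ltW x0)//=.
  rewrite expRN ler_pdivrMr ?expR_gt0//.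
  rewrite mulrAC ler_pdivlMr// -exprSr [leRHS]mulrC -ler_pdivrMr ?ltr0n ?fact_gt0//.
  by apply: le_trans (expR_ge1Dxn n (ltW x0)); rewrite lerDr.
- exact: cvg_cst.
- rewrite -[X in _ --> X](mulr0 n.+1`!%:R); apply: cvgMr.
  apply/gtr0_cvgV0; last exact: cvg_id.
  exact: nbhs_pinfty_gt.
Unshelve. all: by end_near. Qed.

Lemma is_derive_expn_expRN n (x : R) : is_derive x 1 (fun y => y ^+ n * expR (- y))
  (n%:R * x ^+ n.-1 * expR (- x) - x ^+ n * expR (- x)).
Proof.
suff: is_derive x 1 ((id : R -> R) ^+ n * (expR \o -%R))
    (n%:R * x ^+ n.-1 * expR (- x) - x ^+ n * expR (- x)).
  by congr (is_derive _ _ _ _); apply/funext => y; rewrite !fctE.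
apply: is_derive_eq; rewrite /GRing.scale/= !fctE; ring.
Qed.

Lemma expn_expRN_primitive n : exists F : R -> R,
  [/\ forall x : R, is_derive x 1 F (x ^+ n * expR (- x)),
      F 0 = - n`!%:R & F x @[x --> +oo] --> (0 : R)].
Proof.
elim: n => [|n [F [dF F0 Fy]]].
  exists (fun x => - expR (- x)); split.
  - by move=> x; apply: is_derive_eq; rewrite /GRing.scale/= expr0 mul1r mulrN1 opprK.
  - by rewrite oppr0 expR0.
  - by rewrite -oppr0; apply: cvgN; exact: cvgr_expR.
exists (fun x => n.+1%:R * F x - x ^+ n.+1 * expR (- x)); split.
- move=> x; have ? := dF x; have ? := is_derive_expn_expRN n.+1 x.
  suff: is_derive x 1 (n.+1%:R *: F - (fun y => y ^+ n.+1 * expR (- y)))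
    (x ^+ n.+1 * expR (- x)) by [].
  apply: is_derive_eq; rewrite /GRing.scale/=; ring.
- by rewrite F0 expr0n/= mul0r subr0 factS natrM mulrN.
- rewrite -[X in _ --> X](subr0 0) -{1}(mulr0 n.+1%:R); apply: cvgB.
    exact: cvgMr.
  exact: cvg_expn_expRN.
Qed.

(** The factor Gamma(k) cancels in the final quotient, but only because it is
nonzero.  Finiteness of the integral is part of this: the real-valued integral of
a nonnegative function with infinite integral is 0. *)
Lemma GammaS n : Gamma n.+1%:R = n`!%:R :> R.
Proof.
have [F [dF F0 Fy]] := expn_expRN_primitive n.
have ix (x : R) : 0 <= x -> x `^ (n.+1%:R - 1) = x ^+ n.
  by move=> x0; rewrite -natr1 addrK powR_mulrn.
rewrite /Gamma.
transitivity (\int[mu]_(x in `]0, +oo[) (x ^+ n * expR (- x))).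
  by apply: eq_Rintegral => x; rewrite inE/= in_itv/= andbT => x0; rewrite ix ?ltW.
have cf : continuous (fun x : R => x ^+ n * expR (- x)).
  move=> x; apply: differentiable_continuous; apply/derivable1_diffP.
  by have [] := is_derive_expn_expRN n x.
rewrite /Rintegral integral_itv_obnd_cbnd; last first.
  by apply/measurable_EFinP/measurable_funTS; exact: continuous_measurable_fun.
have -> : (\int[mu]_(x in `[0%R, +oo[) (x ^+ n * expR (- x))%:E = 0%:E - (F 0)%:E)%E.
  apply: (ge0_continuous_FTC2y _ _ Fy).
  - by move=> x x0; rewrite mulr_ge0 ?expR_ge0 ?exprn_ge0.
  - exact: continuous_subspaceT.
  - by move=> x _; have [] := dF x.
  - apply/cvg_at_right_filter; apply: differentiable_continuous; apply/derivable1_diffP; exact: ex_derive.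
  - by move=> x _; rewrite derive1E; have [_ ->] := dF x.
by rewrite -EFinB/= F0 sub0r opprK.
Qed.
End Gamma.

Section evidence.
Context {R : realType}.

Lemma sum_category_count k n (y : n.-tuple 'I_k) :
  (\sum_(j < k) category_count y j)%N = n.
Proof.
rewrite -[RHS](size_tuple y) /category_count; elim: (tval y) => [|x s ih] /=.
  by rewrite big1.
rewrite big_split/= ih (bigD1 x)//= eqxx big1 ?addn0// => j /negbTE.
by rewrite eq_sym => ->.
Qed.

(** [m.+1.-1] is the dimension of the parameter of the model with [m.+1] categories;
it is kept unsimplified so that the index types of the model match. *)
Lemma big_ord_pred_recr T (idx : T) (op : Monoid.law idx) m (F : 'I_m.+1 -> T) :
  \big[op/idx]_(j < m.+1) F j =
  op (\big[op/idx]_(j < m.+1.-1) F (widen_ord (leq_pred m.+1) j)) (F ord_max).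
Proof.
rewrite big_ord_recr; congr (op _ _).
by apply: eq_bigr => j _; congr F; exact: val_inj.
Qed.

Variables (m n : nat) (y : n.-tuple 'I_m.+1).
Local Notation w := (widen_ord (leq_pred m.+1)).
Local Notation N := (category_count y).

Lemma joint_kernelE (t : 'rV[R]_m.+1.-1) : joint y t = Gamma m.+1%:R *
  (expR (\sum_(j < m.+1.-1) (N (w j)).+1%:R * t 0 j) /
  (1 + \sum_(j < m.+1.-1) expR (t 0 j)) ^+ (n + m.+1)).
Proof.
rewrite /joint /likelihood /prior.
set D := 1 + _; have D0 : 0 < D.
  by rewrite ltr_pwDl// sumr_ge0// => i _; exact: expR_ge0.
rewrite expRD expRN expRM_natl lnK ?posrE//.
have -> : \sum_(j < m.+1.-1) (N (w j)).+1%:R * t 0 j =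
   \sum_(j < m.+1.-1) (N (w j))%:R * t 0 j + \sum_j t 0 j.
  by rewrite -big_split/=; apply: eq_bigr => j _; rewrite -natr1 mulrDl mul1r.
rewrite expRD exprD invfM.
set a := expR _; set b := expR _; ring.
Qed.

Lemma evidenceE : evidence R y =
  Gamma m.+1%:R * ((\prod_(j < m.+1) (N j)`!)%:R / (n + m)`!%:R).
Proof.
have nE : (\sum_(j < m.+1.-1) (N (w j)).+1 + N ord_max = n + m)%N.
  rewrite -[X in (X + m)%N](sum_category_count y) big_ord_pred_recr/= -addnA [(_ + m)%N]addnC addnA.
  by under eq_bigr do rewrite -addn1; rewrite big_split/= sum1_card card_ord.
have G0 : 0 <= Gamma m.+1%:R :> R by rewrite GammaS.
rewrite /evidence /Rintegral.
transitivity (fine (\int[lebesgue_measure_tuple R m.+1.-1]_t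
  ((Gamma m.+1%:R)%:E * (dirichlet_kernel (fun j => N (w j)) (N ord_max) 1 t)%:E))%E).
  congr fine; apply: eq_integral => t _; rewrite joint_kernelE -EFinM /dirichlet_kernel.
  have -> : (\sum_(i < m.+1.-1) (N (w i)).+1 + (N ord_max).+1 = n + m.+1)%N.
    by rewrite !addnS nE.
  by under eq_bigr do rewrite mxE; under [in X in _ / X]eq_bigr do rewrite mxE.
rewrite ge0_integralZl//; last 2 first.
- by apply/measurable_EFinP; exact: measurable_dirichlet_kernel.
- by move=> t _; rewrite lee_fin dirichlet_kernel_ge0.
rewrite integral_dirichlet_kernel// -EFinM/= expr1n divr1 nE.
by rewrite [in RHS]big_ord_pred_recr.
Qed.
End evidence.

(** * Gibbs' inequality and the Hessian of the log-partition function *)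

Section linalg.
Context {R : comNzRingType}.

(** The two sides are the determinants obtained from the bordered matrix
[block_mx (diag_mx p) p^T p 1] by clearing its last row in two ways. *)
Lemma det_diag_sub_outer m (p : 'rV[R]_m) :
  \det (diag_mx p - p^T *m p) = (\prod_i p 0 i) * (1 - \sum_i p 0 i).
Proof.
pose M := block_mx (diag_mx p) p^T p (1%:M : 'M[R]_1).
pose u : 'rV[R]_m := const_mx 1.
have up : u *m diag_mx p = p.
  by apply/rowP => j; rewrite mul_mx_diag !mxE mul1r.
have e1 : M *m block_mx 1%:M 0 (- p) 1%:M = block_mx (diag_mx p - p^T *m p) p^T 0 1%:M.
  by rewrite mulmx_block !mulmx1 !mulmx0 !mul1mx !add0r mulmxN subrr.
have e2 : block_mx 1%:M 0 (- u) 1%:M *m M =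
    block_mx (diag_mx p) p^T 0 (1 - \sum_i p 0 i)%:M.
  rewrite mulmx_block !mul1mx !mul0mx !addr0 !mulNmx up addNr; congr block_mx.
  rewrite raddfB/= addrC; congr (_ - _).
  apply/matrixP => i j; rewrite !mxE !ord1 mulr1n; apply: eq_bigr => l _.
  by rewrite !mxE mul1r.
have d1 := congr1 determinant e1; have d2 := congr1 determinant e2.
rewrite det_mulmx det_lblock !det1 !mulr1 det_ublock det1 mulr1 in d1.
rewrite det_mulmx det_lblock !det1 !mul1r det_ublock det_diag det_scalar1 in d2.
by rewrite -d1 d2.
Qed.
End linalg.

Section gibbs.
Context {R : realType}.

(** Gibbs' inequality for weights [a] and log-ratios [x], with its equality case:
both follow from x <= e^x - 1, strict for x <> 0. *)
Lemma gibbs_ineq (I : finType) (a x : I -> R) : (forall i, 0 < a i) ->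
  \sum_i a i * expR (x i) = \sum_i a i ->
  \sum_i a i * x i <= 0 /\ (0 <= \sum_i a i * x i -> forall i, x i = 0).
Proof.
move=> a0 ax.
have le i : a i * x i <= a i * expR (x i) - a i.
  by rewrite lerBrDl -[X in X + _]mulr1 -mulrDr ler_pM2l// expR_ge1Dx.
have sE : \sum_i (a i * expR (x i) - a i) = 0 by rewrite sumrB ax subrr.
split; first by rewrite -[leRHS]sE; apply: ler_sum => i _.
move=> s0 i; apply/eqP/negP => /negP xi.
suff : \sum_i a i * x i < 0 by rewrite ltNge s0.
rewrite -[ltRHS]sE (bigD1 i)//= [ltRHS](bigD1 i)//=.
apply: ltr_leD; last by apply: ler_sum => j _.
by rewrite ltrBrDl -[X in X + _]mulr1 -mulrDr ltr_pM2l// expR_gt1Dx.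
Qed.
End gibbs.

Section hessian.
Context {R : realType}.

(** Reduces directional derivatives to one real variable. *)
Lemma derive_line p (W : normedModType R) (f : 'rV[R]_p -> W) (t v : 'rV[R]_p) :
  'D_v f t = 'D_1 (fun h : R => f (h *: v + t)) 0.
Proof.
pose g h := f (h *: v + t).
have H : (fun h : R => h^-1 *: ((f \o shift t) (h *: v) - f t)) =
    (fun h : R => h^-1 *: ((g \o shift 0) (h *: (1 : R)) - g 0)).
  by apply/funext => h; rewrite /g/= scale0r add0r addr0 [h *: 1]mulr1.
by rewrite /derive H.
Qed.

Variable m : nat.

Definition softmax_denom (t : 'rV[R]_m) : R := 1 + \sum_j expR (t 0 j).

(** The shape of the log joint density: an exponential family in its natural
parameter, with log-partition function [A * ln softmax_denom]. *)
Definition log_kernel (A c : R) (a : 'I_m -> R) (t : 'rV[R]_m) : R :=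
  c + (\sum_j a j * t 0 j - A * ln (softmax_denom t)).

Variables (A c : R) (a : 'I_m -> R).
Local Notation D := softmax_denom.
Local Notation J := (log_kernel A c a).

Lemma softmax_denom_gt0 t : 0 < softmax_denom t.
Proof. by rewrite ltr_pwDl// sumr_ge0// => i _; exact: expR_ge0. Qed.

Let coord_line (h : R) (t : 'rV[R]_m) i j :
  (h *: delta_mx 0 j + t) 0 i = t 0 i + (i == j)%:R * h.
Proof. by rewrite !mxE eqxx/= addrC mulrC. Qed.

Let D_line (h : R) t j : D (h *: delta_mx 0 j + t) = D t + expR (t 0 j) * (expR h - 1).
Proof.
rewrite /softmax_denom (bigD1 j)//= [in RHS](bigD1 j)//= coord_line eqxx mul1r expRD.
under eq_bigr => i /negbTE ij do rewrite coord_line ij mul0r addr0.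
ring.
Qed.

Lemma derive_log_kernel j t :
  'D_(delta_mx 0 j) J t = a j - A * (expR (t 0 j) / D t).
Proof.
have Dt := softmax_denom_gt0 t.
rewrite derive_line.
have -> : (fun h : R => J (h *: delta_mx 0 j + t)) =
    (fun h => c + (\sum_j a j * t 0 j + a j * h
      - A * ln (D t + expR (t 0 j) * (expR h - 1)))).
  apply/funext => h; rewrite /log_kernel D_line; congr (_ + (_ - _)).
  under eq_bigr do rewrite coord_line mulrDr; rewrite big_split/=; congr (_ + _).
  rewrite (bigD1 j)//= eqxx mul1r big1 ?addr0// => i /negbTE ->.
  by rewrite mul0r mulr0.
have ? : is_derive (D t + expR (t 0 j) * (expR 0 - 1)) 1 (@ln R) (D t)^-1.
  by rewrite expR0 subrr mulr0 addr0; apply: is_derive1_ln.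
apply: derive_val; apply: is_derive_eq; rewrite /GRing.scale/=.
rewrite expR0; ring.
Qed.

Lemma hessian_log_kernel t : hessian J t =
  \matrix_(i, j) (- A * ((i == j)%:R * (expR (t 0 i) / D t)
    - (expR (t 0 i) / D t) * (expR (t 0 j) / D t))).
Proof.
have Dt := softmax_denom_gt0 t.
apply/matrixP => i j; rewrite !mxE.
rewrite (_ : 'D_(delta_mx 0 j) J = (fun t => a j - A * (expR (t 0 j) / D t))); last first.
  by apply/funext => s; exact: derive_log_kernel.
rewrite derive_line.
under eq_fun do rewrite coord_line D_line.
have ? : D t + expR (t 0 i) * (expR 0 - 1) != 0.
  by rewrite expR0 subrr mulr0 addr0 gt_eqF.
apply: derive_val; apply: is_derive_eq; rewrite /GRing.scale/=.
rewrite expR0 subrr !mulr0 !addr0 subr0 eq_sym.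
have D0 : D t != 0 by rewrite gt_eqF.
by case: (eqVneq i j) => [->|_] /=; rewrite ?mulr1n ?mulr0n; field.
Qed.

End hessian.

(** * The mode and the Laplace approximation *)

Section model.
Context {R : realType}.
Variables (m n : nat) (y : n.-tuple 'I_m.+1).
Local Notation w := (widen_ord (leq_pred m.+1)).

(** The parameters of the Dirichlet posterior and their sum: each category gains
one pseudo-count from the uniform prior. *)
Definition posterior_count (j : 'I_m.+1) : R := (category_count y j).+1%:R.
Definition posterior_total : R := (n + m.+1)%:R.

Local Notation a := posterior_count.
Local Notation A := posterior_total.
Local Notation G := (Gamma m.+1%:R : R).

Let a_gt0 j : 0 < a j. Proof. by rewrite ltr0n. Qed.
Let A_gt0 : 0 < A. Proof. by rewrite ltr0n addnS. Qed.
Let G_gt0 : 0 < G. Proof. by rewrite GammaS ltr0n fact_gt0. Qed.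

Lemma sum_posterior_counts : \sum_(j < m.+1) a j = A.
Proof.
rewrite /a /A -natr_sum; congr (_%:R); under eq_bigr do rewrite -addn1.
by rewrite big_split/= sum_category_count sum1_card card_ord.
Qed.

Lemma joint_log_kernel t :
  joint y t = expR (log_kernel A (ln G) (fun j => a (w j)) t).
Proof.
rewrite joint_kernelE /log_kernel 2!expRD lnK ?posrE// expRN expRM_natl.
by rewrite lnK ?posrE ?softmax_denom_gt0.
Qed.

(** For the candidate th, the log-ratios x t of the category probabilities at t and
at th satisfy sum_i a_i e^(x_i) = A = sum_i a_i, and ln joint(t) - ln joint(th) is
sum_i a_i x_i; so Gibbs' inequality says that th is the unique maximizer, and the
argmax, a choice among maximizers, is th. *)
Lemma posterior_modeE :
  posterior_mode R y = \row_(j < m.+1.-1) ln (a (w j) / a ord_max).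
Proof.
set th := \row_j _.
have ethE j : expR (th 0 j) = a (w j) / a ord_max by rewrite mxE lnK// posrE divr_gt0.
have aE : \sum_(j < m.+1.-1) a (w j) = A - a ord_max.
  by rewrite -sum_posterior_counts big_ord_pred_recr/= addrK.
have DthE : softmax_denom th = A / a ord_max.
  rewrite /softmax_denom; under eq_bigr do rewrite ethE.
  by rewrite -mulr_suml aE mulrBl divff ?gt_eqF// addrC subrK.
pose J := log_kernel A (ln G) (fun j => a (w j)).
pose dl (t : 'rV[R]_m.+1.-1) : R := ln (softmax_denom t) - ln (softmax_denom th).
(* the reference category ord_max has log-odds 0 at every parameter *)
pose x (t : 'rV[R]_m.+1.-1) (i : 'I_m.+1) : R :=
  (if insub (val i) is Some j then t 0 j - th 0 j else 0) - dl t.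
have xw t j : x t (w j) = t 0 j - th 0 j - dl t.
  rewrite /x; case: insubP => [j' _ /= jj'|]; last by rewrite /= ltn_ord.
  by rewrite (_ : j' = j)//; exact: val_inj.
have xm t : x t ord_max = - dl t.
  by rewrite /x insubF ?sub0r//= ltnn.
have Jx t : J t - J th = \sum_i a i * x t i.
  rewrite big_ord_pred_recr/= xm.
  under eq_bigr do rewrite xw mulrBr mulrBr.
  rewrite sumrB sumrB -mulr_suml aE /J /log_kernel /dl; ring.
have xE t : \sum_i a i * expR (x t i) = \sum_i a i.
  have Dt := softmax_denom_gt0 t.
  have edl : expR (- dl t) = A / a ord_max / softmax_denom t.
    by rewrite opprB expRD expRN !lnK ?posrE ?softmax_denom_gt0// DthE.
  rewrite big_ord_pred_recr/= xm edl.
  under eq_bigr do rewrite xw 2!expRD expRN ethE edl.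
  rewrite sum_posterior_counts.
  have -> : \sum_(j < m.+1.-1) a (w j) * (expR (t 0 j) * (a (w j) / a ord_max)^-1 *
      (A / a ord_max / softmax_denom t)) =
    (\sum_(j < m.+1.-1) expR (t 0 j)) * (A / softmax_denom t).
    rewrite mulr_suml; apply: eq_bigr => j _; field.
    by rewrite !gt_eqF.
  have am := a_gt0 ord_max.
  have -> : a ord_max * (A / a ord_max / softmax_denom t) = 1 * (A / softmax_denom t).
    by field; rewrite !gt_eqF.
  rewrite -mulrDl addrC -/(softmax_denom t) mulrC divfK// gt_eqF//.
have max_th : [set t | forall t', joint y t' <= joint y t] th.
  move=> t; rewrite !joint_log_kernel ler_expR -subr_le0 -/J Jx.
  by have [] := gibbs_ineq a_gt0 (xE t).
have max_eq t : (forall t', joint y t' <= joint y t) -> t = th.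
  move=> /(_ th); rewrite !joint_log_kernel ler_expR -subr_ge0 -/J Jx.
  have [_ h] := gibbs_ineq a_gt0 (xE t); move=> /h x0.
  have dl0 : dl t = 0 by apply/eqP; rewrite -oppr_eq0 -xm x0.
  apply/rowP => j; apply/eqP; rewrite -subr_eq0; apply/eqP.
  by have := x0 (w j); rewrite xw dl0 subr0.
rewrite /posterior_mode /argmax; apply: max_eq.
exact: (getPex (ex_intro _ th max_th)).
Qed.

Local Notation th := (posterior_mode R y).

Let softmax_mode j : expR (th 0 j) / softmax_denom th = a (w j) / A.
Proof.
have ethE i : expR (th 0 i) = a (w i) / a ord_max.
  by rewrite posterior_modeE mxE lnK// posrE divr_gt0.
have am := a_gt0 ord_max.
rewrite /softmax_denom; under eq_bigr do rewrite ethE.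
rewrite -mulr_suml ethE -sum_posterior_counts big_ord_pred_recr/=.
have S0 : 0 <= \sum_(j < m.+1.-1) a (w j) by apply: sumr_ge0 => i _; exact: ltW.
by field; rewrite !gt_eqF// ltr_wpDl.
Qed.

Lemma det_neg_hessian_at_mode :
  \det (neg_hessian_at_mode R y) = A ^+ m * \prod_(j < m.+1) (a j / A).
Proof.
pose p : 'rV[R]_m.+1.-1 := \row_j (a (w j) / A).
have -> : neg_hessian_at_mode R y = A *: (diag_mx p - p^T *m p).
  rewrite /neg_hessian_at_mode.
  rewrite (_ : (fun theta => ln (joint y theta)) =
      log_kernel A (ln G) (fun j => a (w j))); last first.
    by apply/funext => t; rewrite joint_log_kernel expRK.
  rewrite hessian_log_kernel; apply/matrixP => i j.
  rewrite !mxE !softmax_mode big_ord1 !mxE mulNr opprK.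
  by congr (_ * (_ - _)); rewrite mulr_natl.
rewrite detZ det_diag_sub_outer big_ord_pred_recr/=; congr (_ * (_ * _)).
  by apply: eq_bigr => j _; rewrite mxE.
under eq_bigr do rewrite mxE.
rewrite -mulr_suml -{1}(divff (lt0r_neq0 A_gt0)) -mulrBl; congr (_ / _).
by rewrite -sum_posterior_counts big_ord_pred_recr/= [X in X - _]addrC addrK.
Qed.

Lemma joint_mode :
  joint y th = G * expR (\sum_(j < m.+1) a j * ln (a j) - A * ln A).
Proof.
have am := a_gt0 ord_max.
rewrite joint_log_kernel /log_kernel expRD lnK ?posrE//; congr (_ * expR _).
have -> : softmax_denom th = A / a ord_max.
  rewrite /softmax_denom.
  under eq_bigr do rewrite posterior_modeE mxE lnK ?posrE ?divr_gt0//.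
  rewrite -mulr_suml -sum_posterior_counts big_ord_pred_recr/= mulrDl divff ?gt_eqF//.
  by rewrite addrC.
rewrite ln_div ?posrE// big_ord_pred_recr/=.
under eq_bigr do rewrite posterior_modeE mxE ln_div ?posrE// mulrBr.
rewrite sumrB -mulr_suml -sum_posterior_counts big_ord_pred_recr/=.
ring.
Qed.

Lemma laplace_approximationE : laplace_approximation R y =
  G * expR (m%:R / 2 * ln (2 * pi) + \sum_(j < m.+1) (a j - 2^-1) * ln (a j)
            - (A - 2^-1) * ln A).
Proof.
have p0 := pi_gt0 R.
rewrite /laplace_approximation joint_mode det_neg_hessian_at_mode.
set d := A ^+ m * _.
have d0 : 0 < d.
  by rewrite mulr_gt0 ?exprn_gt0// prodr_gt0// => j _; rewrite divr_gt0.
have powRE (x z : R) : 0 < x -> x `^ z = expR (z * ln x).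
  by move=> x0; rewrite /powR gt_eqF.
have lnd : ln d = \sum_(j < m.+1) ln (a j) - ln A.
  rewrite /d lnM ?posrE ?exprn_gt0//; last by rewrite prodr_gt0// => j _; rewrite divr_gt0.
  rewrite lnXn//.
  have -> : \prod_(j < m.+1) (a j / A) = expR (\sum_(j < m.+1) ln (a j / A)).
    by rewrite expR_sum; apply: eq_bigr => j _; rewrite lnK// posrE divr_gt0.
  rewrite expRK.
  under eq_bigr do rewrite ln_div ?posrE//.
  rewrite sumrB sumr_const card_ord mulrSr; ring.
rewrite (powRE (2 * pi)) ?mulr_gt0// (powRE d)// lnd mulrCA -!expRD; congr (_ * expR _).
under [in RHS]eq_bigr do rewrite mulrBl.
rewrite sumrB -mulr_sumr.
by field.
Qed.

Lemma evidence_laplace_ratio : evidence R y / laplace_approximation R y =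
  expR (\sum_(j < m.+1) stirling_remainder R (category_count y j).+1
        - stirling_remainder R (n + m.+1)).
Proof.
(* ln Gamma(k) = ln k! - ln k *)
have fE k : (0 < k)%N -> ln k.-1`!%:R = log_stirling_error R k + (k%:R - 2^-1) * ln k%:R - k%:R.
  case: k => // k _; rewrite /log_stirling_error factS natrM lnM ?posrE ?ltr0n ?fact_gt0//=.
  by field.
rewrite laplace_approximationE evidenceE.
rewrite -mulf_div divff ?gt_eqF// mul1r -expRN.
have eE : (\prod_(j < m.+1) (category_count y j)`!)%:R / (n + m)`!%:R =
   expR (\sum_(j < m.+1) ln (category_count y j)`!%:R - ln (n + m)`!%:R) :> R.
  rewrite expRD expRN lnK ?posrE ?ltr0n ?fact_gt0// expR_sum natr_prod; congr (_ / _).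
  by apply: eq_bigr => j _; rewrite lnK// posrE ltr0n fact_gt0.
rewrite eE -expRD; congr expR.
have -> : ln (n + m)`!%:R = log_stirling_error R (n + m.+1) + (A - 2^-1) * ln A - A.
  by rewrite /A addnS; exact: (fE (n + m).+1).
have fN j : ln (category_count y j)`!%:R =
    log_stirling_error R (category_count y j).+1 + (a j - 2^-1) * ln (a j) - a j.
  exact: (fE (category_count y j).+1).
under eq_bigr do rewrite fN.
rewrite sumrB big_split/= sum_posterior_counts /stirling_remainder.
rewrite sumrB sumr_const card_ord mulrSr -[_ *+ m]mulr_natl.
by field.
Qed.
End model.

(** * The lower bound *)

Section bounds.
Context {R : realType}.

(** The harmonic mean is at most the arithmetic mean c, because 1/x is above its
tangent at c. *)
Lemma sum_inv_ge (k : nat) (x : 'I_k -> R) : (forall i, 0 < x i) -> (0 < k)%N ->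
  k%:R ^+ 2 / (\sum_i x i) <= \sum_i (x i)^-1.
Proof.
move=> x0 k0; have k0' : 0 < k%:R :> R by rewrite ltr0n.
case: k => // k in x x0 k0 k0' *.
have S0 : 0 < \sum_i x i.
  rewrite big_ord_recl ltr_pwDl// sumr_ge0// => i _; exact: ltW.
set S := \sum_i x i in S0 *; pose c := S / k.+1%:R.
have c0 : 0 < c by rewrite divr_gt0.
have tangent i : 2 / c - x i / c ^+ 2 <= (x i)^-1.
  rewrite -subr_ge0.
  have -> : (x i)^-1 - (2 / c - x i / c ^+ 2) = (x i - c) ^+ 2 / (x i * c ^+ 2).
    by field; rewrite !gt_eqF.
  by rewrite divr_ge0 ?sqr_ge0// mulr_ge0 ?sqr_ge0// ltW.
apply: (@le_trans _ _ (\sum_i (2 / c - x i / c ^+ 2))); last first.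
  by apply: ler_sum => i _.
rewrite sumrB sumr_const card_ord -mulr_suml -/S -[_ *+ k.+1]mulr_natl.
rewrite /c le_eqVlt; apply/predU1P; left; field.
by rewrite !gt_eqF.
Qed.

(** For large n the right-hand side is about (k^2 - 1) / (12 n), which exceeds
1 / (5 n) since k >= 2; the threshold 100 is convenient rather than sharp. *)
Lemma gap_bound (k n : R) : 2 <= k -> 100 <= n ->
  1 / (5 * n) <= k ^+ 2 / (12 * (n + k) + k) - (12 * (n + k))^-1.
Proof.
move=> k2 n1; rewrite -subr_ge0.
have -> : k ^+ 2 / (12 * (n + k) + k) - (12 * (n + k))^-1 - 1 / (5 * n) =
  (60 * n * (n + k) * k ^+ 2 - 5 * n * (12 * n + 13 * k) - 12 * (n + k) * (12 * n + 13 * k)) /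
  ((12 * (n + k) + k) * (12 * (n + k)) * (5 * n)).
  by field; lra.
apply: divr_ge0; last by rewrite !mulr_ge0//; lra.
have k4 : 0 <= k ^+ 2 - 4 by rewrite expr2; nra.
have n4 : 0 <= 5 * n ^+ 2 - 156 by rewrite expr2; nra.
have nk : 0 <= 4 * n * k - 125 by nra.
(* every summand is nonnegative since k ^+ 2 >= 4 and n >= 100 *)
have -> : 60 * n * (n + k) * k ^+ 2 - 5 * n * (12 * n + 13 * k)
    - 12 * (n + k) * (12 * n + 13 * k) =
    51 * n ^+ 2 * (k ^+ 2 - 4) + 60 * n * k * (k ^+ 2 - 4)
    + n * k * (4 * n * k - 125) + k ^+ 2 * (5 * n ^+ 2 - 156) by ring.
by rewrite !addr_ge0// !mulr_ge0// ?sqr_ge0//; lra.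
Qed.

End bounds.

Theorem theorem3p4 (R : realType) (k : nat) (hk : (2 <= k)%N)
    (psi : 'I_k -> R) (hpsi : psi \in simplex R k)
    (d : measure_display) (T : measurableType d) (P : probability T R)
    (Y : nat -> T -> 'I_k) (hY : iid_categorical P psi Y) :
  {ae P, forall w : T, exists N0 : nat, forall n : nat, (N0 < n)%N ->
    let y := [tuple Y i w | i < n] in
    1 / (5 * n%:R) <= `|evidence R y / laplace_approximation R y - 1| }.
Proof.
(* the threshold of [gap_bound] serves every sample *)
apply: aeW => w; exists 100%N => n n100 /=.
move: (mktuple _) => y.
case: k hk y {psi hpsi Y hY} => // m hk y.
have n0 : 0 < n%:R :> R by rewrite ltr0n; exact: leq_ltn_trans n100.
rewrite evidence_laplace_ratio.
set g := (X in expR X).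
have gE : 1 / (5 * n%:R) <= g.
  have k2 : 2 <= m.+1%:R :> R by rewrite (ler_nat R 2).
  have n1 : 100 <= n%:R :> R by rewrite (ler_nat R 100) ltnW.
  apply: le_trans (gap_bound k2 n1) _.
  rewrite /g lerB//; last first.
    have A0 : (0 < n + m.+1)%N by rewrite addnS.
    have /andP[_] := robbins_bounds R A0.
    by rewrite (natrD _ n).
  pose x (j : 'I_m.+1) : R := 12 * (category_count y j).+1%:R + 1.
  have x0 j : 0 < x j by rewrite ltr_wpDl// mulr_ge0.
  apply: (@le_trans _ _ (\sum_j (x j)^-1)).
    have -> : 12 * (n%:R + m.+1%:R) + m.+1%:R = \sum_j x j.
      rewrite /x big_split/= sumr_const card_ord -mulr_sumr sum_posterior_counts.
      by rewrite /posterior_total (natrD _ n).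
    exact: sum_inv_ge x0 (ltn0Sn m).
  apply: ler_sum => j _.
  by have /andP[] := robbins_bounds R (ltn0Sn (category_count y j)).
rewrite ger0_norm; last first.
  rewrite subr_ge0 -expR0 ler_expR; apply: le_trans gE.
  by rewrite divr_ge0// mulr_ge0// ltW.
by rewrite lerBrDl; apply: le_trans (expR_ge1Dx g); rewrite lerD2l.
Qed.
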